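(* Let $H$ be a directed $k$-uniform hypergraph. For any acyclic set $A$ of $H$, we have $\Theta(H)\geq |A|$.
   Context: A directed $k$-uniform hypergraph is a pair $H=(V,E)$ with $V$ finite and $E$ a set of $k$-tuples of elements of $V$. To $H$ associate the directed graph $G_H$ with vertex set $V$ and edge set $\{(a_1,a_2):(a_1,a_2,\dots,a_k)\in E\text{ for some }a_3,\dots,a_k\}$. For $A\subseteq V$, $H[A]$ is the directed $k$-uniform hypergraph with vertices $A$ and edges $E\cap A^{\times k}$. $A$ is an acyclic set of $H$ if $G_{H[A]}$ is a directed acyclic graph. The strong product $G\boxtimes H$ has vertex set $V_G\times V_H$, and $((g_1,h_1),\dots,(g_k,h_k))$ is an edge iff either ($g_1=\dots=g_k$ and $(h_i)_i\in E_H$), or ($(g_i)_i\in E_G$ and $h_1=\dots=h_k$), or ($(g_i)_i\in E_G$ and $(h_i)_i\in E_H$). $H^{\boxtimes n}$ is the $n$-fold strong product. An independent set contains no edge entirely; $\alpha(H)$ is the maximum size of an independent set; $\Theta(H)=\lim_{n\to\infty}\alpha(H^{\boxtimes n})^{1/n}$. *)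

(* Defs.v *)
From mathcomp Require Import all_boot all_order all_algebra.
From mathcomp Require Import all_classical all_reals all_analysis.

Set Implicit Arguments.
Unset Strict Implicit.
Unset Printing Implicit Defensive.

Import GRing.Theory Num.Theory.
Import numFieldNormedType.Exports.
Local Open Scope ring_scope.
Local Open Scope classical_set_scope.

(* Edges are arbitrary k-tuples: repeated entries, and constant tuples, are
   allowed. *)
Record dhypergraph (k : nat) := DHypergraph {
  vertex : finType;
  edge : {set k.-tuple vertex}
}.

(* The edge relation of the digraph G_H.  It is only meaningful for k >= 2 (for
   smaller k no tuple has a prefix of length 2 and the relation is empty). *)
Definition assoc_digraph (k : nat) (H : dhypergraph k) : rel (vertex H) :=
  [rel a1 a2 | [exists t in edge H, prefix [:: a1; a2] t]].

Definition induced_subhypergraph (k : nat) (H : dhypergraph k)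
    (A : {set vertex H}) :
    dhypergraph k :=
  @DHypergraph k {x : vertex H | x \in A}
    [set t | map_tuple val t \in edge H]%SET.

(* No directed cycle; loops are the cycles of length 1. *)
Definition acyclic_digraph (T : finType) (e : rel T) : Prop :=
  forall p : seq T, ucycle e p -> p = [::].

Definition acyclic_set (k : nat) (H : dhypergraph k) (A : {set vertex H}) :
    Prop :=
  acyclic_digraph (@assoc_digraph k (induced_subhypergraph A)).

Definition strong_product (k : nat) (G H : dhypergraph k) : dhypergraph k :=
  @DHypergraph k (vertex G * vertex H)%type
    [set t : k.-tuple (vertex G * vertex H) |
      let g := map_tuple fst t in let h := map_tuple snd t in
      [|| constant g && (h \in edge H),
          (g \in edge G) && constant h
        | (g \in edge G) && (h \in edge H)]]%SET.

Definition point_hypergraph (k : nat) : dhypergraph k :=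
  @DHypergraph k unit finset.set0.

(* For n > 0 this is H * (H * ( ... * H)) with n factors; for n = 0 it is the
   one-vertex edgeless hypergraph, which does not affect the limit below. *)
Definition strong_power (k : nat) (H : dhypergraph k) (n : nat) :
    dhypergraph k :=
  iterop n (@strong_product k) H (point_hypergraph k).

Definition independent (k : nat) (H : dhypergraph k) (S : {set vertex H}) :
    bool :=
  [forall t in edge H, ~~ all [in S] t].

Definition alpha (k : nat) (H : dhypergraph k) : nat :=
  (\max_(S : {set vertex H} | independent S) #|S|)%N.

Definition Theta (R : realType) (k : nat) (H : dhypergraph k) : R :=
  lim ((fun n : nat => (alpha (strong_power H n))%:R `^ (n%:R^-1) : R) @ \oo).

(* Main.v *)
Require Import Defs.
From mathcomp Require Import all_boot all_order all_algebra.
From mathcomp Require Import all_classical all_reals all_analysis.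
From mathcomp Require Import lra.
Import Order.TTheory GRing.Theory Num.Theory.
Import numFieldNormedType.Exports.

(** The sequence [alpha (H^n)] is supermultiplicative, so by Fekete's lemma
    [Theta H] is a genuine limit and dominates every [alpha (H^n)^(1/n)].
    An acyclic set [A] carries a rank that strictly increases from the first to
    the second entry of every edge inside [A].  On [A^n] the sum of the ranks
    strictly increases along every edge of [H^n], hence its level sets are
    independent; it takes at most [n M + 1] values, so some level set has at
    least [|A|^n / (n M + 1)] elements. *)

Local Open Scope ring_scope.

Section Combinatorics.
Local Open Scope nat_scope.
Variable k : nat.
Implicit Types G H : dhypergraph k.

(** * Constant tuples and edges of strong products *)

Lemma constant_tnthP (T : eqType) (t : k.-tuple T) :
  reflect (forall i j, tnth t i = tnth t j) (constant t).
Proof.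
apply: (iffP idP) => [ct i j|ct].
  have /(constantP (tnth t i))[x et] := ct.
  suff tx l : tnth t l = x by rewrite !tx.
  by rewrite (tnth_nth x) et nth_nseq size_tuple ltn_ord.
case: k t ct => [|n] t ct; first by rewrite tuple0.
apply/(constantP (tnth t ord0)); exists (tnth t ord0).
apply/all_pred1P/allP => x /tnthP[i ->] /=.
by rewrite (ct i ord0).
Qed.

Lemma constant_map_tuple (T U : eqType) (f : T -> U) (t : k.-tuple T) :
  constant t -> constant (map_tuple f t).
Proof.
move=> /constant_tnthP ct; apply/constant_tnthP => i j.
by rewrite !tnth_map (ct i j).
Qed.

Lemma constant_map_tuple_inj (T U : eqType) (f : T -> U) (t : k.-tuple T) :
  injective f -> constant (map_tuple f t) = constant t.
Proof.
move=> fI; apply/idP/idP => [/constant_tnthP ct|].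
  by apply/constant_tnthP => i j; have := ct i j; rewrite !tnth_map => /fI.
exact: constant_map_tuple.
Qed.

Lemma constant_pairs (T U : eqType) (t : k.-tuple (T * U)) :
  constant t = constant (map_tuple fst t) && constant (map_tuple snd t).
Proof.
apply/idP/andP => [ct|[/constant_tnthP c1 /constant_tnthP c2]].
  by split; apply: constant_map_tuple.
apply/constant_tnthP => i j.
have := c1 i j; have := c2 i j; rewrite !tnth_map.
by case: (tnth t i) (tnth t j) => [a b] [c d] /= -> ->.
Qed.

Lemma map_tuple_comp (T U W : Type) (f : U -> W) (g : T -> U) (t : k.-tuple T) :
  map_tuple f (map_tuple g t) = map_tuple (f \o g) t.
Proof. by apply: eq_from_tnth => i; rewrite !tnth_map. Qed.

Lemma edge_strong_product G H (t : k.-tuple (vertex G * vertex H)) :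
  (t \in edge (strong_product G H)) =
  [|| constant (map_tuple fst t) && (map_tuple snd t \in edge H),
      (map_tuple fst t \in edge G) && constant (map_tuple snd t)
    | (map_tuple fst t \in edge G) && (map_tuple snd t \in edge H)].
Proof. by rewrite inE. Qed.

(** * Independent sets, embeddings and supermultiplicativity *)

Lemma card_le_alpha G (S : {set vertex G}) : independent S -> #|S| <= alpha G.
Proof.
exact: (@leq_bigmax_cond _ (@independent k G) (fun S : {set vertex G} => #|S|)).
Qed.

Lemma independentP G (S : {set vertex G}) :
  reflect (forall t, t \in edge G -> ~ (forall i, tnth t i \in S))
          (independent S).
Proof.
apply: (iffP forall_inP) => iS t /iS nS.
  by move=> /all_tnthP aS; move/negP: nS.
by apply/negP => /all_tnthP.
Qed.

Lemma alpha_attained G :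
  0 < k -> exists2 S : {set vertex G}, independent S & #|S| = alpha G.
Proof.
move=> k0; have [|S iS e] := @eq_bigmax_cond _
  [pred S : {set vertex G} | independent S] (fun S : {set vertex G} => #|S|).
  (* As [k] is positive, every edge has an entry, so the empty set is independent. *)
  apply/card_gt0P; exists (finset.set0 : {set vertex G}).
  by apply/independentP => t _ /(_ (Ordinal k0)); rewrite inE.
by exists S => //; rewrite -e.
Qed.

(** An injection that reflects edges carries independent sets to independent sets; it serves to
    compare products that agree only up to reassociation of pairs. *)
Definition embeds G H := exists2 f : vertex G -> vertex H, injective f &
  forall t, map_tuple f t \in edge H -> t \in edge G.

Lemma embeds_trans G1 G2 G3 : embeds G1 G2 -> embeds G2 G3 -> embeds G1 G3.
Proof.
move=> [f fI fE] [g gI gE]; exists (g \o f); first exact: inj_comp.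
by move=> t; rewrite -map_tuple_comp => /gE/fE.
Qed.

Lemma embeds_alpha G H : 0 < k -> embeds G H -> alpha G <= alpha H.
Proof.
move=> k0 [f fI fE]; have [S /independentP iS <-] := alpha_attained G k0.
rewrite -(card_imset S fI); apply/card_le_alpha/independentP => t tE aS.
have tf i : exists x, x \in S /\ tnth t i = f x.
  by have /imsetP[x xS ->] := aS i; exists x.
have [x0 _] := tf (Ordinal k0).
(* Lifts [t] entrywise through [f]; the default [x0] is never reached, since each entry has a
   preimage in [S]. *)
pose u := map_tuple (fun y => odflt x0 [pick x in S | f x == y]) t.
have uP i : tnth u i \in S /\ f (tnth u i) = tnth t i.
  rewrite tnth_map; case: pickP => [x /= /andP[xS /eqP]//|].
  by have [x [xS ->]] := tf i => /(_ x) /=; rewrite xS eqxx.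
apply: (iS u) => [|i]; last by have [] := uP i.
apply: fE; suff -> : map_tuple f u = t by [].
by apply: eq_from_tnth => i; rewrite tnth_map; have [] := uP i.
Qed.

Lemma embeds_strong_productr F G H :
  embeds G H -> embeds (strong_product F G) (strong_product F H).
Proof.
move=> [f fI fE]; exists (fun p : vertex F * vertex G => (p.1, f p.2)).
  by move=> [a b] [c d] [-> /fI ->].
set g := (X in map_tuple X) => t.
have e1 : map_tuple fst (map_tuple g t) = map_tuple fst t.
  by apply: eq_from_tnth => l; rewrite !tnth_map.
have e2 : map_tuple snd (map_tuple g t) = map_tuple f (map_tuple snd t).
  by apply: eq_from_tnth => l; rewrite !tnth_map.
rewrite !edge_strong_product e1 e2 (constant_map_tuple_inj _ _ _ _ fI).
case/or3P => /andP[h1 h2]; apply/or3P.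
- by apply: Or31; rewrite h1 fE.
- by apply: Or32; rewrite h1 h2.
- by apply: Or33; rewrite h1 fE.
Qed.

Lemma embeds_strong_productA F G H :
  embeds (strong_product (strong_product F G) H)
         (strong_product F (strong_product G H)).
Proof.
exists (fun p : (vertex F * vertex G) * vertex H => (p.1.1, (p.1.2, p.2))).
  by move=> [[a b] c] [[d e] f] [-> -> ->].
set f := (X in map_tuple X) => t.
have e1 : map_tuple fst (map_tuple f t) = map_tuple fst (map_tuple fst t).
  by apply: eq_from_tnth => l; rewrite !tnth_map.
have e2 : map_tuple fst (map_tuple snd (map_tuple f t)) =
    map_tuple snd (map_tuple fst t).
  by apply: eq_from_tnth => l; rewrite !tnth_map.
have e3 : map_tuple snd (map_tuple snd (map_tuple f t)) = map_tuple snd t.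
  by apply: eq_from_tnth => l; rewrite !tnth_map.
rewrite !edge_strong_product !constant_pairs e1 e2 e3.
(* What remains is a Boolean implication in six atoms: constancy and edge membership of the three
   projections. *)
by do 6!case: (_ \in _) || case: (constant _).
Qed.

(** Every edge of the product projects to an edge of some factor, so a product of independent sets
    is independent. *)
Lemma alpha_strong_product G H :
  0 < k -> alpha G * alpha H <= alpha (strong_product G H).
Proof.
move=> k0; have [S /independentP iS <-] := alpha_attained G k0.
have [T /independentP iT <-] := alpha_attained H k0.
rewrite -cardsX; apply: card_le_alpha; apply/independentP => t.
rewrite edge_strong_product => tE tST.
have tS i : tnth (map_tuple fst t) i \in S.
  by rewrite tnth_map; have := tST i; rewrite inE => /andP[].
have tT i : tnth (map_tuple snd t) i \in T.
  by rewrite tnth_map; have := tST i; rewrite inE => /andP[].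
case/or3P: tE => /andP[h1 h2].
- exact: iT h2 tT.
- exact: iS h1 tS.
- exact: iS h1 tS.
Qed.

Lemma alpha_le_card G : alpha G <= #|vertex G|.
Proof. by apply/bigmax_leqP => S _; apply: max_card. Qed.

(** [iterop] makes the first power [H] itself, so the recursion starts at the second power and
    exponent zero is treated apart below. *)
Lemma strong_powerS H n :
  strong_power H n.+2 = strong_product H (strong_power H n.+1).
Proof. by []. Qed.

Lemma card_strong_power H n : #|vertex (strong_power H n)| = #|vertex H| ^ n.
Proof.
case: n => [|n]; first by rewrite card_unit.
elim: n => [//|n IH].
by rewrite strong_powerS card_prod IH -expnS.
Qed.

Lemma embeds_strong_powerD H m n :
  embeds (strong_product (strong_power H m.+1) (strong_power H n.+1))
         (strong_power H (m.+1 + n.+1)).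
Proof.
elim: m => [|m IH].
  exists id => [|t]; first exact: inj_id.
  suff -> : map_tuple id t = t by [].
  by apply: eq_from_tnth => l; rewrite tnth_map.
apply: embeds_trans (embeds_strong_productA _ _ _) _.
exact: embeds_strong_productr.
Qed.

Lemma alpha_strong_powerD H m n : 0 < k ->
  alpha (strong_power H m) * alpha (strong_power H n)
    <= alpha (strong_power H (m + n)).
Proof.
move=> k0.
have a0 : alpha (strong_power H 0) <= 1.
  by rewrite (leq_trans (alpha_le_card _))// card_unit.
case: m => [|m]; first by rewrite add0n -[leqRHS]mul1n leq_mul2r a0 orbT.
case: n => [|n]; first by rewrite addn0 -[leqRHS]muln1 leq_mul2l a0 orbT.
apply: leq_trans (alpha_strong_product _ _ k0) _.
exact/(embeds_alpha _ _ k0)/embeds_strong_powerD.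
Qed.

(** * Weights increasing along edges *)

(* [c] is the size of a set on which a weight bounded by [M] strictly increases
   from entry [i] to entry [j] of every edge contained in it. *)
Definition graded i j G c M :=
  exists (S : {set vertex G}) (w : vertex G -> nat),
  [/\ #|S| = c, {in S, forall v, w v <= M} &
   forall t, t \in edge G -> (forall l, tnth t l \in S) ->
     w (tnth t i) < w (tnth t j)].

(** The weights add up: along any edge one strictly increases while the other is constant or
    increases too. *)
Lemma graded_strong_product i j G H c d M N :
  graded i j G c M -> graded i j H d N ->
  graded i j (strong_product G H) (c * d) (M + N).
Proof.
move=> [S [v [cS vM vE]]] [T [w [cT wN wE]]].
exists (finset.setX S T), (fun p => v p.1 + w p.2); split.
- by rewrite cardsX cS cT.
- by move=> [x y]; rewrite inE => /andP[xS yT]; rewrite leq_add ?vM ?wN.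
move=> t; rewrite edge_strong_product => tE tST.
have tS l : tnth (map_tuple fst t) l \in S.
  by rewrite tnth_map; have := tST l; rewrite inE => /andP[].
have tT l : tnth (map_tuple snd t) l \in T.
  by rewrite tnth_map; have := tST l; rewrite inE => /andP[].
rewrite -!(tnth_map fst) -!(tnth_map snd).
case/or3P: tE => /andP[h1 h2].
- by rewrite (constant_tnthP _ _ h1 i j) ltn_add2l wE.
- by rewrite (constant_tnthP _ _ h2 i j) ltn_add2r vE.
- by rewrite -addSn leq_add ?vE// ltnW// wE.
Qed.

Lemma graded_strong_power i j H c M n :
  graded i j H c M -> graded i j (strong_power H n) (c ^ n) (n * M).
Proof.
move=> gH; case: n => [|n].
  exists [set: unit]%SET, (fun=> 0); split => //.
    by rewrite cardsT card_unit.
  by move=> t; rewrite inE.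
elim: n => [|n IH]; first by rewrite mul1n.
by rewrite strong_powerS expnS mulSn; apply: graded_strong_product.
Qed.

(** Pigeonhole: the weight has at most [M.+1] level sets on [S], each independent because the weight
    cannot increase inside one. *)
Lemma graded_alpha i j G c M : graded i j G c M -> c <= M.+1 * alpha G.
Proof.
move=> [S [w [<- wM wE]]].
rewrite -sum1_card (partition_big (fun v => inord (w v) : 'I_M.+1) predT) //=.
rewrite -[M.+1 in leqRHS]card_ord -sum_nat_const; apply: leq_sum => l _.
rewrite sum1dep_card; apply/card_le_alpha/independentP => t tE tS.
have wl m : tnth t m \in S /\ w (tnth t m) = l.
  have := tS m; rewrite inE => /andP[mS /eqP <-]; split => //.
  by rewrite inordK// ltnS wM.
have := wE t tE (fun m => proj1 (wl m)).
by rewrite (proj2 (wl i)) (proj2 (wl j)) ltnn.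
Qed.

(** * Ranks from acyclicity *)

Lemma acyclic_connect (T : finType) (e : rel T) x y :
  acyclic_digraph e -> e x y -> ~~ connect e y x.
Proof.
move=> ac exy; apply/negP => /connectP[p yp xE].
(* [ucycle] forbids repeated vertices, so the path from [y] back to [x] is first made
   repetition-free. *)
case/shortenP: yp xE => q yq uq _ xE.
suff /ac : ucycle e (y :: q) by [].
by rewrite /ucycle /ucycleb uq andbT/= rcons_path yq -xE.
Qed.

(** The rank counts the vertices that reach [y]. Across an edge from [x] to [y] this set keeps all
    that reach [x] and gains [y] itself. *)
Lemma acyclic_rank (T : finType) (e : rel T) : acyclic_digraph e ->
  exists w : T -> nat, forall x y, e x y -> w x < w y.
Proof.
move=> ac; exists (fun y => #|[set x | connect e x y]%SET|) => x y exy.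
apply/proper_card/properP; split.
  apply/fintype.subsetP => z; rewrite !inE => zx.
  exact: connect_trans zx (connect1 exy).
by exists y; rewrite !inE ?connect0// acyclic_connect.
Qed.

Lemma acyclic_set_graded H (A : {set vertex H}) (i j : 'I_k) :
  i = 0 :> nat -> j = 1 :> nat -> acyclic_set A ->
  exists M, graded i j H #|A| M.
Proof.
move=> i0 j1 /acyclic_rank[r rE].
(* The rank lives on the subtype of [A]; it is extended by zero. *)
pose w v := if insub v is Some x then r x else 0.
exists (\max_v w v), A, w; split => // [v _|t tE tA]; first exact: leq_bigmax.
pose u := [tuple exist (fun x => x \in A) (tnth t l) (tA l) | l < k].
have uE : map_tuple val u = t.
  by apply: eq_from_tnth => l; rewrite tnth_map tnth_mktuple.
have wE l : w (tnth t l) = r (tnth u l).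
  by rewrite -uE tnth_map /w valK.
clearbody u; rewrite !wE; apply: rE.
apply/existsP; exists u; rewrite inE uE tE /=.
have k2 : 1 < k by rewrite -j1.
rewrite (tnth_nth (tnth u i) u i) (tnth_nth (tnth u i) u j) i0 j1.
have : size u = k by rewrite size_tuple.
move: (tval u) (tnth u i) => s x0.
case: s => [|x [|y s]] /= sz; try by rewrite -sz in k2.
by rewrite !eqxx prefix0s.
Qed.

End Combinatorics.

(** * Fekete's lemma for roots *)

Section Analysis.
Local Open Scope classical_set_scope.
Variable R : realType.

Lemma cvg_powR_sub_inv (c : R) (m : nat) : 0 < c ->
  c `^ (1 - m%:R / n%:R) @[n --> \oo] --> c.
Proof.
move=> c0; have cN0 : (c == 0) = false by rewrite gt_eqF.
rewrite /powR cN0 -[X in _ --> X](lnK c0) -[X in expR X]mul1r.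
apply: continuous_cvg; first exact: continuous_expR.
apply: cvgMr_tmp; rewrite -[X in _ --> X](subr0 1).
apply: cvgB; first exact: cvg_cst.
rewrite -(mulr0 m%:R); apply: cvgMl_tmp.
apply/gtr0_cvgV0.
  by near=> n; rewrite ltr0n; near: n; exact: nbhs_infty_gt.
exact: cvgr_idn.
Unshelve. all: by end_near. Qed.

(** Divide [n] by [m]; the factor of the remainder is at least 1 and is dropped. *)
Lemma supermultiplicative_expn (a : nat -> nat) (m n : nat) :
  (forall i, 0 < a i)%N -> (forall i j, a i * a j <= a (i + j))%N ->
  (a m ^ (n %/ m) <= a n)%N.
Proof.
move=> a0 aM; rewrite [in a n](divn_eq n m).
apply: leq_trans (aM _ _); rewrite -[leqLHS]muln1 leq_mul//.
elim: (n %/ m)%N => [|q IH]; first by rewrite mul0n.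
by rewrite expnS mulSn; apply: leq_trans (aM _ _); rewrite leq_mul2l IH orbT.
Qed.

(* Fekete's lemma: the limit is the supremum of the roots. *)
Lemma supermultiplicative_cvg_root (a : nat -> nat) (K : nat) :
  (forall n, 0 < a n)%N -> (forall m n, a m * a n <= a (m + n))%N ->
  (forall n, a n <= K ^ n)%N ->
  exists2 s : R, (a n)%:R `^ n%:R^-1 @[n --> \oo] --> s &
    forall n, (a n)%:R <= s ^+ n.
Proof.
move=> a0 aM aK; pose b n : R := (a n)%:R `^ n%:R^-1.
have bX n : (0 < n)%N -> b n ^+ n = (a n)%:R.
  move=> n0; rewrite -powR_mulrn ?powR_ge0// -powRrM mulVf ?powRr1//.
  by rewrite pnatr_eq0 -lt0n.
have b_ge1 n : 1 <= b n.
  by rewrite -[leLHS](powRr0 (a n)%:R) ler_powR// ler1n.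
have b_ge0 n : 0 <= b n by exact: powR_ge0.
have bK n : (0 < n)%N -> b n <= K%:R.
  move=> n0; rewrite -(@ler_pXn2r _ n)// ?nnegrE//.
  by rewrite bX// -natrX ler_nat.
(* Index zero is left out, its root being 1 by the convention on the inverse of zero. *)
pose E := [set b n.+1 | n in [set: nat]].
have supE : has_sup E.
  split; first by exists (b 1%N); exists 0%N.
  by exists K%:R => _ [n _ <-]; exact: bK.
have b_sup n : (0 < n)%N -> b n <= sup E.
  by case: n => // n _; apply: (sup_upper_bound supE); exists n.
exists (sup E) => [|[|n]]; last 2 first.
- by rewrite expr0 -[1]/(1%:R) ler_nat; exact: aK 0%N.
- by rewrite -bX// lerXn2r ?nnegrE// ?(le_trans _ (b_sup n.+1 _)).
apply/cvgrPdist_lt => e e0.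
have [m m0 bm] : exists2 m, (0 < m)%N & sup E - e < b m.
  by have [_ [m _ <-] bm] := sup_adherent e0 supE; exists m.+1.
have c0 : 0 < b m by exact: lt_le_trans ltr01 (b_ge1 m).
near=> n.
have n0 : (0 < n)%N by near: n; exact: nbhs_infty_gt.
have nR0 : (n%:R : R) != 0 by rewrite pnatr_eq0 -lt0n.
have lim_n : sup E - e < b m `^ (1 - m%:R / n%:R).
  near: n; exact: cvgr_gt (cvg_powR_sub_inv _ m c0) _ bm.
rewrite -/(b n) ger0_norm ?subr_ge0 ?b_sup// ltrBlDr -ltrBlDl.
apply: (lt_le_trans lim_n).
(* Compares exponents of [b m >= 1], using [n - m <= m * (n %/ m)]. *)
apply: (@le_trans _ _ ((a m ^ (n %/ m))%:R `^ n%:R^-1)).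
  rewrite natrX -(bX m m0) -exprM -(powR_mulrn _ (b_ge0 m)) -powRrM.
  apply: ler_powR; first exact: b_ge1.
  rewrite ler_pdivlMr ?ltr0n// mulrBl mul1r divfK// lerBlDr -natrD ler_nat.
  by rewrite -mulnSr mulnC ltnW// ltn_ceil.
rewrite ge0_ler_powR ?nnegrE ?invr_ge0 ?ler0n//.
by rewrite ler_nat supermultiplicative_expn.
Unshelve. all: by end_near. Qed.

(** * Exponential against linear growth *)

Lemma bernoulli (x : R) n : 0 <= x -> 1 + n%:R * x <= (1 + x) ^+ n.
Proof.
move=> x0; elim: n => [|n IH]; first by rewrite mul0r addr0 expr0.
rewrite exprS -natr1.
have : (1 + x) * (1 + n%:R * x) <= (1 + x) * (1 + x) ^+ n.
  by rewrite ler_wpM2l// addr_ge0.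
apply: le_trans; have : 0 <= n%:R * x * x by rewrite !mulr_ge0.
lra.
Qed.

Lemma le_of_expn_le_linear (x s : R) (M : nat) : 0 < s ->
  (forall n, x ^+ n <= (n * M).+1%:R * s ^+ n) -> x <= s.
Proof.
move=> s0 xs; rewrite leNgt; apply/negP => sx.
pose y := x / s - 1.
have y0 : 0 < y by rewrite subr_gt0 ltr_pdivlMr// mul1r.
have yM n : (1 + y) ^+ n <= (n * M).+1%:R.
  by rewrite addrC subrK expr_div_n ler_pdivrMr ?exprn_gt0.
(* Chosen so that the quadratic term [(n y)^2] exceeds [2 n M]. *)
pose n := (Num.truncn (2 * M%:R / y ^+ 2)).+1.
have n_gt : 2 * M%:R < n%:R * y ^+ 2.
  by rewrite -ltr_pdivrMr ?exprn_gt0// truncnS_gt.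
have n0 : 0 < n%:R :> R by rewrite ltr0n.
clearbody n y.
(* Bernoulli alone is only linear in [n]; squaring it, at exponent [2 n], yields the quadratic
   term. *)
have n_le : 1 + 2 * n%:R * y + (n%:R * y) ^+ 2 <= 1 + 2 * n%:R * M%:R.
  have := yM (n * 2)%N; rewrite exprM => /(le_trans _) le_.
  have -> : 1 + 2 * n%:R * M%:R = (n * 2 * M).+1%:R :> R.
    by rewrite -[RHS]natr1 !natrM; lra.
  apply: le_.
  have -> : 1 + 2 * n%:R * y + (n%:R * y) ^+ 2 = (1 + n%:R * y) ^+ 2 by lra.
  have yn0 : 0 <= n%:R * y by rewrite mulr_ge0 ?ltW.
  rewrite lerXn2r ?nnegrE ?bernoulli ?addr_ge0 ?exprn_ge0 ?(ltW y0)//.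
  by rewrite addr_ge0 ?ltW.
have : 0 < n%:R * (n%:R * y ^+ 2 - 2 * M%:R) by rewrite mulr_gt0// subr_gt0.
have : 0 < n%:R * y by rewrite mulr_gt0.
lra.
Qed.

End Analysis.

Theorem theorem2p21 (R : realType) (k : nat) (hk : (2 <= k)%N)
    (H : dhypergraph k) (A : {set vertex H}) (hA : acyclic_set A) :
  #|A|%:R <= Theta R H.
Proof.
have k0 : (0 < k)%N by exact: ltnW.
rewrite /Theta.
set u := (X in lim X).
have [A0|A0] := posnP #|A|.
  (* For empty [A] convergence is not at hand; a divergent [lim] takes the default value zero. *)
  rewrite A0; have [cu|ncu] := pselect (cvg u); last by rewrite dvgP.
  by apply: limr_ge => //; near=> n; exact: powR_ge0.
have [M gA] :=
  @acyclic_set_graded k H A (Ordinal k0) (Ordinal hk) erefl erefl hA.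
have card_le n : (#|A| ^ n <= (n * M).+1 * alpha (strong_power H n))%N.
  exact/graded_alpha/graded_strong_power/gA.
have alpha_gt0 n : (0 < alpha (strong_power H n))%N.
  have : (0 < (n * M).+1 * alpha (strong_power H n))%N.
    by apply: leq_trans (card_le n); rewrite expn_gt0 A0.
  by rewrite muln_gt0.
have alpha_le n : (alpha (strong_power H n) <= #|vertex H| ^ n)%N.
  by rewrite -card_strong_power alpha_le_card.
have [s us alpha_s] := @supermultiplicative_cvg_root R _ _ alpha_gt0
  (fun m n => alpha_strong_powerD _ H m n k0) alpha_le.
(* Since [alpha (H^n) <= s^n], the bound [card_le] gives [|A|^n <= (n M + 1) s^n] for every [n],
   which forces [|A| <= s]. *)
rewrite (cvg_lim _ us)//; apply: (@le_of_expn_le_linear _ _ _ M) => [|n].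
  by apply: lt_le_trans (alpha_s 1%N); rewrite ltr0n.
apply: (@le_trans _ _ ((n * M).+1%:R * (alpha (strong_power H n))%:R)).
  by rewrite -natrX -natrM ler_nat.
by rewrite ler_wpM2l.
Unshelve. all: by end_near. Qed.
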